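(* Let $A\in\mathbb{M}_n^+$ and let $X,Y\in\mathbb{M}_n$ be normal. Then, for all $p\ge 1$, $$|A(X+Y)A|^p \prec_{w\log} 2^{p-1}A^p(|X|^p+|Y|^p)A^p.$$
   Context: $\mathbb{M}_n$ is the space of $n\times n$ complex matrices, $\mathbb{M}_n^+$ its positive semidefinite part, and $|X|=(X^*X)^{1/2}$. For $S,T\in\mathbb{M}_n^+$, $S\prec_{w\log}T$ means $\prod_{j=1}^k\lambda_j(S)\le\prod_{j=1}^k\lambda_j(T)$ for every $k=1,\ldots,n$, where $\lambda_1(\cdot)\ge\cdots\ge\lambda_n(\cdot)$ are the eigenvalues arranged in decreasing order (with multiplicity). *)

(* Defs.v *)
From mathcomp Require Import all_boot all_order all_algebra.
From mathcomp Require Import sesquilinear spectral.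
From mathcomp Require Import complex.
From mathcomp Require Import reals exp.

Set Implicit Arguments.
Unset Strict Implicit.
Unset Printing Implicit Defensive.

Import Order.TTheory GRing.Theory Num.Theory.

Local Open Scope ring_scope.
Local Open Scope complex_scope.
Local Open Scope sesquilinear_scope.

(* The order on R[i] is the partial one: 0 <= z means that z is real and
   nonnegative. *)
Definition psdmx (R : realType) (n : nat) (A : 'M[R[i]]_n) : Prop :=
  A \is hermsymmx /\ forall x : 'cV[R[i]]_n, 0 <= (x ^t* *m A *m x) 0 0.

(* A `^ p by functional calculus in the spectral decomposition
   A = P^-1 *m diag_mx d *m P. It is meant for positive semidefinite A (and
   p > 0), where the entries of d are real and nonnegative, so that taking the
   real part loses nothing. *)
Definition powmx (R : realType) (n : nat) (A : 'M[R[i]]_n) (p : R) :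
    'M[R[i]]_n :=
  let P := spectralmx A in
  let d := map_mx (fun z : R[i] => (complex.Re z `^ p)%:C) (spectral_diag A) in
  invmx P *m diag_mx d *m P.

Definition absmx (R : realType) (n : nat) (X : 'M[R[i]]_n) : 'M[R[i]]_n :=
  powmx (X ^t* *m X) 2^-1.

(* The roots of the characteristic polynomial, with multiplicity, in decreasing
   order. It is meant for matrices with real spectrum, hence the real part. *)
Definition eigenvalues (R : realType) (n : nat) (A : 'M[R[i]]_n) : seq R :=
  sort >=%R
    [seq complex.Re z | z <- sval (closed_field_poly_normal (char_poly A))].

(* Indices are shifted: lambda_j is entry j.-1 of the sequence. *)
Definition wlog_maj (R : realType) (n : nat) (S T : 'M[R[i]]_n) : Prop :=
  forall k : nat, (1 <= k <= n)%N ->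
    \prod_(j < k) (eigenvalues S)`_j <= \prod_(j < k) (eigenvalues T)`_j.

(* Main.v *)
(* By the spectral theorem A, |X| and |Y| have the form T = P^* diag(r) P with P
   unitary and r >= 0, and then T^t = P^* diag(r^t) P ([upow]).  With
     M_t := [|X|^(t/2) A^t; |Y|^(t/2) A^t] (a column of two blocks),
     H_t := M_t^* M_t = A^t (|X|^t + |Y|^t) A^t,
   let L(t) be the product of the k largest eigenvalues of H_t.

   By the Cauchy-Binet formula the product of the k largest eigenvalues of
   H >= 0 is the best constant c in det(V^* H V) <= c det(V^* V), V ranging over
   the n x k matrices, and |det(V^* W)|^2 <= det(V^* V) det(W^* W).  This
   replaces the passage to exterior powers.

   Writing X = |X|^(1/2) U |X|^(1/2) and Y = |Y|^(1/2) U' |Y|^(1/2), the matrix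
   A (X + Y) A is M_1^* diag(U, U') M_1 with U, U' unitary, so the product of
   its k largest singular values is at most L(1).

   H_((s+t)/2) and M_s^* M_t have the same nonzero eigenvalues, whence
   L((s+t)/2)^2 <= L(s) L(t).  As L is bounded on [0, p], it is log-convex
   there, and L(0) = 2^k gives L(1)^p <= 2^(k (p - 1)) L(p). *)
From HB Require Import structures.
Require Import Defs.
From mathcomp Require Import all_boot all_order all_algebra.
From mathcomp Require Import sesquilinear spectral.
From mathcomp Require Import complex.
From mathcomp Require Import reals exp.
From mathcomp Require Import fingroup perm classical_sets sequences lra ring.

Import Order.TTheory GRing.Theory Num.Theory.

Local Open Scope ring_scope.
Local Open Scope complex_scope.
Local Open Scope sesquilinear_scope.

Set Implicit Arguments.
Unset Strict Implicit.

(** * Determinants of products: Cauchy-Binet and Cauchy-Schwarz *)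

(** Multilinearity in the rows: row [i] of [A *m B] combines rows of [B], and [f] picks one of them
    for each [i]. *)
Lemma det_mulmx_sum (F : comNzRingType) (k n : nat) (A : 'M[F]_(k, n))
    (B : 'M[F]_(n, k)) :
  \det (A *m B) =
  \sum_(f : {ffun 'I_k -> 'I_n}) (\prod_i A i (f i)) * \det (rowsub f B).
Proof.
rewrite /determinant.
transitivity (\sum_(s : 'S_k) \sum_(f : {ffun 'I_k -> 'I_n})
   (\prod_i A i (f i)) * ((-1) ^+ s * \prod_i B (f i) (s i))).
  apply: eq_bigr => s _; under eq_bigr do rewrite mxE.
  rewrite bigA_distr_bigA mulr_sumr; apply: eq_bigr => f _.
  by rewrite big_split mulrCA.
rewrite exchange_big; apply: eq_bigr => f _; rewrite mulr_sumr.
apply: eq_bigr => s _; congr (_ * (_ * _)).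
by apply: eq_bigr => i _; rewrite mxE.
Qed.

(* Each minor is counted once per ordering of its index set, whence the factor
   [k`!]; the non-injective [f] contribute 0. *)
Lemma cauchy_binet (F : comNzRingType) (k n : nat) (A : 'M[F]_(k, n))
    (B : 'M[F]_(n, k)) :
  \det (A *m B) *+ k`! =
  \sum_(f : {ffun 'I_k -> 'I_n}) \det (colsub f A) * \det (rowsub f B).
Proof.
(* The factorial becomes a sum over permutations [s]; in copy [s], composing [f] with [s] brings out
   the sign that builds [\det (colsub f A)]. *)
rewrite -card_Sn -sumr_const.
transitivity (\sum_(s : 'S_k) \sum_(f : {ffun 'I_k -> 'I_n})
   ((-1) ^+ s * \prod_i A i (f (s i))) * \det (rowsub f B)).
  apply: eq_big => [s|s _]; first by rewrite inE.
  rewrite det_mulmx_sum.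
  rewrite (reindex (fun f : {ffun 'I_k -> 'I_n} => [ffun i => f (s i)])) /=.
    apply: eq_bigr => f _.
    have -> : rowsub [ffun i => f (s i)] B = row_perm s (rowsub f B).
      by apply/matrixP => i j; rewrite !mxE ffunE.
    rewrite row_permE det_mulmx det_perm [LHS]mulrC [RHS]mulrAC; congr (_ * _).
    by apply: eq_bigr => i _; rewrite ffunE.
  exists (fun f : {ffun 'I_k -> 'I_n} => [ffun i => f ((s^-1)%g i)]) => f _;
    by apply/ffunP => i; rewrite !ffunE ?permK ?permKV.
rewrite exchange_big; apply: eq_bigr => f _; rewrite -mulr_suml.
congr (_ * _); apply: eq_bigr => s _; congr (_ * _).
by apply: eq_bigr => i _; rewrite mxE.
Qed.

Lemma det_rowsub_noninj (F : comNzRingType) (k n : nat) (B : 'M[F]_(n, k))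
    (f : 'I_k -> 'I_n) : ~ injective f -> \det (rowsub f B) = 0.
Proof.
move=> /injectiveP /injectivePn [i [j ij fij]].
by apply: (determinant_alternate ij) => l; rewrite !mxE fij.
Qed.

Lemma trmxC_mul (C : numClosedFieldType) (m n p : nat) (A : 'M[C]_(m, n))
    (B : 'M[C]_(n, p)) : (A *m B) ^t* = B ^t* *m A ^t*.
Proof. by rewrite trmx_mul map_mxM. Qed.

Lemma det_trmxC (C : numClosedFieldType) (n : nat) (A : 'M[C]_n) :
  \det (A ^t*) = (\det A)^*%R.
Proof. by rewrite det_map_mx det_tr. Qed.

Lemma colsub_trmxC (C : numClosedFieldType) (k n : nat) (A : 'M[C]_(n, k))
    (f : 'I_k -> 'I_n) : colsub f (A ^t*) = (rowsub f A) ^t*.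
Proof. by apply/matrixP => i j; rewrite !mxE. Qed.

Lemma cauchy_schwarz_sum (C : numClosedFieldType) (I : finType) (u v : I -> C) :
  `|\sum_i (u i)^*%R * v i| ^+ 2 <= (\sum_i `|u i| ^+ 2) * (\sum_i `|v i| ^+ 2).
Proof.
pose row (w : I -> C) : 'rV[C]_#|I| := \row_i w (enum_val i).
have /= := (CauchySchwarz (@dotmx C #|I|) (row v) (row u)).1.
rewrite !dotmxE !mxE.
have E (w z : I -> C) :
    \sum_j row w 0 j * ((row z) ^t*) j 0 = \sum_i (z i)^*%R * w i.
  rewrite [RHS](reindex (@enum_val I I)) /=; last first.
    by apply: onW_bij; apply: enum_val_bij.
  by apply: eq_bigr => j _; rewrite !mxE mulrC.
rewrite !E mulrC; congr (_ <= _ * _); apply: eq_bigr => i _;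
  by rewrite normCK mulrC.
Qed.

(** By Cauchy-Binet the three determinants are, up to the factorial, inner products of the vectors
    of [k]-rowed minors of [A] and [B]. *)
Lemma det_cauchy_schwarz (C : numClosedFieldType) (k n : nat)
    (A B : 'M[C]_(n, k)) :
  `|\det (A ^t* *m B)| ^+ 2 <= \det (A ^t* *m A) * \det (B ^t* *m B).
Proof.
have k0 : 0 < (k`!%:R : C) ^+ 2 by rewrite exprn_gt0 // ltr0n fact_gt0.
rewrite -(ler_pM2l k0) -[X in X <= _]exprMn [X in _ <= X * _]expr2 mulrACA.
rewrite -[X in (X * `|_|) ^+ 2](@normr_nat C k`!) -normrM.
rewrite !mulr_natl !cauchy_binet.
under eq_bigr do rewrite colsub_trmxC det_trmxC.
under [X in _ <= X * _]eq_bigr do rewrite colsub_trmxC det_trmxC mulrC -normCK.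
under [X in _ <= _ * X]eq_bigr do rewrite colsub_trmxC det_trmxC mulrC -normCK.
exact: cauchy_schwarz_sum.
Qed.

Lemma det_gram_ge0 (C : numClosedFieldType) (k n : nat) (A : 'M[C]_(n, k)) :
  0 <= \det (A ^t* *m A).
Proof.
rewrite -(@pmulrn_lge0 _ _ k`!) ?fact_gt0 // cauchy_binet.
by apply: sumr_ge0 => f _; rewrite colsub_trmxC det_trmxC mulrC -normCK exprn_ge0.
Qed.

(** Counting from 0, the [i]-th smallest value of an injective [f] is at least [i], and [l] is
    nonincreasing. *)
Lemma ler_prod_inj (R : numDomainType) (n k : nat) (l : nat -> R)
    (f : 'I_k -> 'I_n) :
  (forall i, (i < n)%N -> 0 <= l i) ->
  (forall i j, (i <= j)%N -> (j < n)%N -> l j <= l i) -> injective f ->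
  \prod_(i < k) l (f i) <= \prod_(i < k) l i.
Proof.
move=> l0 ldec finj.
pose s := sort leq [seq nat_of_ord (f i) | i <- enum 'I_k].
have ss : size s = k by rewrite size_sort size_map size_enum_ord.
have us : sorted ltn s.
  rewrite ltn_sorted_uniq_leq sort_sorted ?andbT; last exact: leq_total.
  rewrite sort_uniq map_inj_uniq ?enum_uniq //.
  by move=> i j /val_inj /finj.
have ls i : (i < k)%N -> (i <= nth 0%N s i < n)%N.
  move=> ik; apply/andP; split; last first.
    have : nth 0%N s i \in s by rewrite mem_nth // ss.
    by rewrite mem_sort => /mapP [j _ ->].
  elim: i ik => // i IH ik; apply: leq_ltn_trans (IH (ltnW ik)) _.
  have := sorted_ltn_nth ltn_trans 0%N us; apply; rewrite ?inE ?ss //.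
  exact: ltnW.
have -> : \prod_(i < k) l (f i) = \prod_(x <- s) l x.
  by rewrite (perm_big _ (permEl (perm_sort leq _))) big_map big_enum.
rewrite (big_nth 0%N) ss big_mkord; apply: ler_prod => i _.
by have /andP[h1 h2] := ls i (ltn_ord i); rewrite l0 // ldec.
Qed.

(** In the Cauchy-Binet expansion the diagonal matrix weights each nonzero minor by [k] entries of
    [l] at distinct indices, whose product is largest for the first [k]. *)
Lemma det_diag_bound (C : numClosedFieldType) (k n : nat) (l : nat -> C)
    (W : 'M[C]_(n, k)) :
  (forall i, (i < n)%N -> 0 <= l i) ->
  (forall i j, (i <= j)%N -> (j < n)%N -> l j <= l i) ->
  \det (W ^t* *m diag_mx (\row_(i < n) l i) *m W) <=
    (\prod_(i < k) l i) * \det (W ^t* *m W).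
Proof.
Proof.
move=> l0 ldec.
rewrite -(ler_pMn2r (fact_gt0 k)) -mulrnAr !cauchy_binet mulr_sumr.
apply: ler_sum => f _.
have -> : colsub f (W ^t* *m diag_mx (\row_(i < n) l i)) =
    (rowsub f W) ^t* *m diag_mx (\row_(i < k) l (f i)).
  by apply/matrixP => i j; rewrite !mul_mx_diag !mxE.
rewrite det_mulmx colsub_trmxC det_trmxC det_diag mulrAC mulrC.
have [/injectiveP finj|/injectiveP fninj] := boolP (injectiveb f); last first.
  by rewrite det_rowsub_noninj // !mulr0.
apply: ler_wpM2r; first by rewrite mulrC -normCK exprn_ge0.
under eq_bigr do rewrite mxE.
exact: ler_prod_inj.
Qed.

(** * Unitary diagonalization and functional calculus *)

HB.lock Definition unidiag (C : numClosedFieldType) (n : nat) (P : 'M[C]_n)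
  (d : 'rV[C]_n) : 'M[C]_n := P ^t* *m diag_mx d *m P.

Lemma unidiag_unlock (C : numClosedFieldType) (n : nat) (P : 'M[C]_n)
    (d : 'rV[C]_n) : unidiag P d = P ^t* *m diag_mx d *m P.
Proof. by rewrite unidiag.unlock. Qed.

Lemma unidiagE (C : numClosedFieldType) (n : nat) (P : 'M[C]_n)
    (d : 'rV[C]_n) i j :
  unidiag P d i j = \sum_k (P k i)^*%R * d 0 k * P k j.
Proof. by rewrite !unidiag_unlock mul_mx_diag mxE; apply: eq_bigr => k _; rewrite !mxE. Qed.

Lemma unidiag_mul (C : numClosedFieldType) (n : nat) (P : 'M[C]_n)
    (d e : 'rV[C]_n) : P \is unitarymx ->
  unidiag P d *m unidiag P e = unidiag P (\row_i (d 0 i * e 0 i)).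
Proof.
move=> uP; rewrite !unidiag_unlock !mulmxA mulmxtVK // -(mulmxA _ (diag_mx d)).
by rewrite mulmx_diag.
Qed.

Lemma unidiag_trmxC (C : numClosedFieldType) (n : nat) (P : 'M[C]_n)
    (d : 'rV[C]_n) :
  (unidiag P d) ^t* = unidiag P (map_mx Num.conj d).
Proof.
rewrite !unidiag_unlock !trmxC_mul trmxCK mulmxA; congr (_ *m _ *m _).
by rewrite tr_diag_mx map_diag_mx.
Qed.

Lemma unidiag1 (C : numClosedFieldType) (n : nat) (P : 'M[C]_n) :
  P \is unitarymx -> unidiag P (const_mx 1) = 1%:M.
Proof.
move=> uP; rewrite !unidiag_unlock diag_const_mx mulmx1.
by rewrite -invmx_unitary // mulVmx // unitarymx_unit.
Qed.

Lemma unidiagZ (C : numClosedFieldType) (n : nat) (P : 'M[C]_n) (c : C)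
    (d : 'rV[C]_n) : c *: unidiag P d = unidiag P (c *: d).
Proof. by rewrite !unidiag_unlock linearZ /= -scalemxAr -scalemxAl. Qed.

Lemma unidiag_normal (C : numClosedFieldType) (n : nat) (P : 'M[C]_n)
    (d : 'rV[C]_n) : P \is unitarymx -> unidiag P d \is normalmx.
Proof.
move=> uP; apply/normalmxP; rewrite unidiag_trmxC !unidiag_mul //.
by congr unidiag; apply/rowP => i; rewrite !mxE mulrC.
Qed.

Lemma unidiag_perm (C : numClosedFieldType) (n : nat) (P : 'M[C]_n)
    (d : 'rV[C]_n) (s : 'S_n) :
  unidiag (row_perm s P) (\row_i d 0 (s i)) = unidiag P d.
Proof.
apply/matrixP => i j; rewrite !unidiagE [RHS](reindex_inj (@perm_inj _ s)).
by apply: eq_bigr => k _; rewrite !mxE.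
Qed.

Lemma row_perm_unitary (C : numClosedFieldType) (n : nat) (P : 'M[C]_n)
    (s : 'S_n) : P \is unitarymx -> row_perm s P \is unitarymx.
Proof.
move=> uP; rewrite row_permE mul_unitarymx //; apply/unitarymxP.
rewrite tr_perm_mx map_perm_mx -perm_mxM mulgV perm_mx1 //.
Qed.

Lemma unidiag_fun (C : numClosedFieldType) (n : nat) (P Q : 'M[C]_n)
    (d e : 'rV[C]_n) (f : C -> C) : P \is unitarymx -> Q \is unitarymx ->
  unidiag P d = unidiag Q e ->
  unidiag P (map_mx f d) = unidiag Q (map_mx f e).
Proof.
(* The change of basis [P *m Q ^t*] intertwines the two diagonal matrices, so
   its (i, j) entry vanishes unless [d 0 i = e 0 j]. *)
move=> uP uQ PQ; pose W := P *m Q ^t*.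
have uW D E : unidiag P D = unidiag Q E <-> diag_mx D *m W = W *m diag_mx E.
  rewrite !unidiag_unlock /W; split=> [H|H].
    have /(congr1 (fun M => P *m M *m Q ^t*)) := H.
    by rewrite !mulmxA (unitarymxP uP) mul1mx mulmxtVK.
  have /(congr1 (fun M => P ^t* *m M *m Q)) := H.
  rewrite -(invmx_unitary uP) -(invmx_unitary uQ) !mulmxA mulVmx ?unitarymx_unit //.
  by rewrite mul1mx mulmxKV ?unitarymx_unit.
clearbody W; apply/uW; have /uW/matrixP dW := PQ; apply/matrixP => i j.
have := dW i j; rewrite !(mul_diag_mx, mul_mx_diag) !mxE.
have [->|Wn0] := eqVneq (W i j) 0; first by rewrite !mulr0 !mul0r.
by rewrite mulrC => /(mulfI Wn0) ->; rewrite mulrC.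
Qed.

Lemma normal_unidiag (C : numClosedFieldType) (n : nat) (A : 'M[C]_n) :
  A \is normalmx ->
  A = unidiag (spectralmx A) (spectral_diag A).
Proof.
move=> /orthomx_spectralP; rewrite !unidiag_unlock invmx_unitary //.
exact: spectral_unitarymx.
Qed.

(** [powmx] is defined through [spectralmx]; by [unidiag_fun] any other unitary diagonalization
    yields the same power. *)
Lemma powmx_unidiag (R : realType) (n : nat) (P : 'M[R[i]]_n)
    (d : 'rV[R[i]]_n) (t : R) : P \is unitarymx ->
  powmx (unidiag P d) t =
  unidiag P (map_mx (fun z : R[i] => (complex.Re z `^ t)%:C) d).
Proof.
move=> uP; have powE (A : 'M[R[i]]_n) : powmx A t = unidiag (spectralmx A)
    (map_mx (fun z : R[i] => (complex.Re z `^ t)%:C) (spectral_diag A)).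
  rewrite unidiag_unlock -(invmx_unitary (spectral_unitarymx A)).
  reflexivity.
rewrite powE; have specE := normal_unidiag (unidiag_normal d uP).
exact: unidiag_fun (spectral_unitarymx _) uP (esym specE).
Qed.

Lemma char_poly_unidiag (C : numClosedFieldType) (n : nat) (P : 'M[C]_n)
    (d : 'rV[C]_n) : P \is unitarymx ->
  char_poly (unidiag P d) = \prod_(z <- [seq d 0 i | i <- enum 'I_n]) ('X - z%:P).
Proof.
move=> uP; rewrite big_map big_enum /=.
transitivity (char_poly (diag_mx d)); last first.
  rewrite char_poly_trig ?diag_mx_is_trig //.
  by apply: eq_bigr => i _; rewrite mxE eqxx mulr1n.
rewrite /char_poly /char_poly_mx !unidiag_unlock.
have PP : map_mx polyC (P ^t*) *m map_mx polyC P = 1%:M.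
  by rewrite -map_mxM -invmx_unitary // mulVmx ?unitarymx_unit // map_mx1.
have -> : 'X%:M - map_mx polyC (P ^t* *m diag_mx d *m P) =
    map_mx polyC (P ^t*) *m ('X%:M - map_mx polyC (diag_mx d)) *m map_mx polyC P.
  rewrite mulmxBr mulmxBl !map_mxM; congr (_ - _).
  by rewrite scalar_mxC -mulmxA PP mulmx1.
by rewrite !det_mulmx mulrAC -det_mulmx PP det1 mul1r.
Qed.

(** The root list behind [eigenvalues] is determined only up to a permutation, which sorting
    erases. *)
Lemma eigenvalues_unidiag (R : realType) (n : nat) (P : 'M[R[i]]_n)
    (d : 'rV[R[i]]_n) : P \is unitarymx ->
  eigenvalues (unidiag P d) =
  sort >=%R [seq complex.Re (d 0 i) | i <- enum 'I_n].
Proof.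
move=> uP; rewrite /eigenvalues; case: closed_field_poly_normal => /= s.
rewrite (monicP (char_poly_monic _)) scale1r char_poly_unidiag // => /prod_XsubC_eq ds.
apply/perm_sortP; [exact: ge_total|exact: ge_trans|exact: ge_anti|].
have -> : [seq complex.Re (d 0 i) | i <- enum 'I_n] =
    map (@complex.Re R) [seq d 0 i | i <- enum 'I_n] by rewrite -map_comp.
by rewrite perm_map // perm_sym.
Qed.

(** * Positive semidefinite matrices and their ordered eigenvalues *)

Lemma psdmx_unidiag (R : realType) (n : nat) (A : 'M[R[i]]_n) : psdmx A ->
  exists2 P, P \is unitarymx & exists2 r : 'rV[R]_n, (forall i, 0 <= r 0 i) &
  A = unidiag P (map_mx (real_complex R) r).
Proof.
move=> [hA A0]; have uP := spectral_unitarymx A.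
have AE := normal_unidiag (hermitian_normalmx hA).
exists (spectralmx A) => //.
have d0 i : 0 <= spectral_diag A 0 i.
  (* The quadratic form at the [i]-th eigenvector is the [i]-th eigenvalue. *)
  have := A0 ((spectralmx A) ^t* *m delta_mx i 0).
  rewrite trmxC_mul trmxCK {2}AE !unidiag_unlock !mulmxA mulmxtVK // mulmxtVK //.
  rewrite mul_mx_diag mxE (bigD1 i) //= big1 ?addr0 => [|j ji]; last first.
    by rewrite !mxE (negPf ji) mulr0.
  by rewrite !mxE !eqxx conjC1 mul1r mulr1.
exists (map_mx (@complex.Re R) (spectral_diag A)).
  by move=> i; have := d0 i; rewrite mxE lecE /= => /andP[].
rewrite [LHS]AE; congr unidiag; apply/rowP => i; rewrite !mxE.
by rewrite RRe_real // ger0_real.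
Qed.

Lemma psdmx_gram (R : realType) (m n : nat) (M : 'M[R[i]]_(m, n)) :
  psdmx (M ^t* *m M).
Proof.
split; first by apply/is_hermitianmxP; rewrite scale1r trmxC_mul trmxCK.
move=> x; have -> : x ^t* *m (M ^t* *m M) *m x = (M *m x) ^t* *m (M *m x).
  by rewrite trmxC_mul !mulmxA.
rewrite mxE sumr_ge0 // => i _.
by rewrite !mxE mulrC mul_conjC_ge0.
Qed.

Lemma psdmx_sorted (R : realType) (n : nat) (A : 'M[R[i]]_n) : psdmx A ->
  [/\ forall i, (i < n)%N -> 0 <= (eigenvalues A)`_i,
      forall i j, (i <= j)%N -> (j < n)%N ->
        (eigenvalues A)`_j <= (eigenvalues A)`_i,
      size (eigenvalues A) = n &
      exists2 P, P \is unitarymx &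
      A = unidiag P (\row_i ((eigenvalues A)`_i)%:C)].
Proof.
move=> /psdmx_unidiag [P uP [r r0 AE]].
pose s := [seq r 0 i | i <- enum 'I_n].
have eA : eigenvalues A = sort >=%R s.
  by rewrite AE eigenvalues_unidiag //; congr sort; apply: eq_map => i; rewrite mxE.
have sA : size (eigenvalues A) = n by rewrite eA size_sort size_map size_enum_ord.
have pA : perm_eq (eigenvalues A) s by rewrite eA perm_sort.
split => //.
- move=> i ilt; have : (eigenvalues A)`_i \in s.
    by rewrite -(perm_mem pA) mem_nth // sA.
  by case/mapP => j _ ->.
- move=> i j ij jn.
  have := sorted_leq_nth (@ge_trans _ R) (@ge_refl _ R) 0 (sort_sorted (@ge_total _ R) s).
  by rewrite -eA; apply; rewrite ?inE ?sA // (leq_ltn_trans ij).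
have st : size s == n by rewrite size_map size_enum_ord.
(* The sorting permutation is absorbed into the basis by permuting the rows of [P]. *)
have /tuple_permP [σ Es] : perm_eq (eigenvalues A) (Tuple st) := pA.
exists (row_perm σ P); first exact: row_perm_unitary.
rewrite [LHS]AE -(unidiag_perm _ _ σ); congr unidiag; apply/rowP => i.
rewrite !mxE Es -tnth_nth tnth_mktuple (tnth_nth 0) /= (nth_map i) ?size_enum_ord //.
by rewrite nth_ord_enum.
Qed.

(** * Products of the [k] largest eigenvalues *)

(** For positive semidefinite [H] and [k <= n] this is the norm of the [k]-th exterior power of
    [H]. *)
Definition topprod (R : realType) (n k : nat) (H : 'M[R[i]]_n) : R :=
  \prod_(j < k) (eigenvalues H)`_j.

Lemma topprod_ge0 (R : realType) (n k : nat) (H : 'M[R[i]]_n) :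
  psdmx H -> (k <= n)%N -> 0 <= topprod k H.
Proof.
move=> /psdmx_sorted [l0 _ _ _] kn; apply: prodr_ge0 => j _.
by apply: l0; apply: leq_trans kn.
Qed.

(** [det_diag_bound] applies to [P *m V], which has the same Gram matrix as [V]. *)
Lemma det_le_topprod (R : realType) (n k : nat) (H : 'M[R[i]]_n)
    (V : 'M[R[i]]_(n, k)) : psdmx H ->
  \det (V ^t* *m H *m V) <= (topprod k H)%:C * \det (V ^t* *m V).
Proof.
move=> /psdmx_sorted [l0 ldec _ [P uP HE]].
have := @det_diag_bound _ _ _ (fun i => ((eigenvalues H)`_i)%:C) (P *m V).
rewrite -rmorph_prod.
have -> : (P *m V) ^t* *m (P *m V) = V ^t* *m V.
  rewrite trmxC_mul mulmxA -(mulmxA _ _ P) -invmx_unitary //.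
  by rewrite mulVmx ?unitarymx_unit // mulmx1.
have <- : V ^t* *m H *m V = (P *m V) ^t* *m
    diag_mx (\row_i ((eigenvalues H)`_i)%:C) *m (P *m V).
  by rewrite trmxC_mul [in LHS]HE unidiag_unlock !mulmxA.
apply=> [i ilt|i j ij jn]; first by rewrite ler0c l0.
by rewrite lecR ldec.
Qed.

(** Such a [V] attains equality in [det_le_topprod]. *)
Lemma top_eigenvectors (R : realType) (n k : nat) (H : 'M[R[i]]_n) :
  psdmx H -> (k <= n)%N ->
  exists2 V : 'M[R[i]]_(n, k), V ^t* *m V = 1%:M &
  H *m V = V *m diag_mx (\row_(j < k) ((eigenvalues H)`_j)%:C).
Proof.
move=> /psdmx_sorted [l0 ldec _ [P uP HE]] kn.
exists (colsub (widen_ord kn) (P ^t*)).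
  apply/matrixP => i j; have /unitarymxP/matrixP := uP.
  move=> /(_ (widen_ord kn i) (widen_ord kn j)); rewrite !mxE => E.
  have -> : (i == j) = (widen_ord kn i == widen_ord kn j) by rewrite -!val_eqE.
  by rewrite -E; apply: eq_bigr => l _; rewrite !mxE conjCK.
have HP : H *m P ^t* = P ^t* *m diag_mx (\row_i ((eigenvalues H)`_i)%:C).
  by rewrite [in LHS]HE unidiag_unlock mulmxtVK.
rewrite mulmx_colsub HP; apply/matrixP => i j.
by rewrite !mul_mx_diag !mxE.
Qed.

Lemma top_eigenvectors_det (R : realType) (n k : nat) (H : 'M[R[i]]_n) :
  \det (diag_mx (\row_(j < k) ((eigenvalues H)`_j)%:C)) = (topprod k H)%:C.
Proof.
by rewrite det_diag /topprod rmorph_prod; apply: eq_bigr => j _; rewrite mxE.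
Qed.

Lemma real_complex_normr (R : realType) (x : R) : `|x%:C| ^+ 2 = (x ^+ 2)%:C.
Proof. by rewrite -normrX rmorphXn ger0_norm // -rmorphXn ler0c sqr_ge0. Qed.

(* [N *m D] and [D *m N] have the same nonzero spectrum, and the top
   eigenvalue product of [Ms ^t* *m Mt] is controlled by Cauchy-Schwarz. *)
Lemma topprod_swap (R : realType) (m n k : nat) (N D : 'M[R[i]]_n)
    (Ms Mt : 'M[R[i]]_(m, n)) : psdmx (N *m D) ->
  Ms ^t* *m Mt = D *m N -> (k <= n)%N ->
  topprod k (N *m D) ^+ 2 <=
    topprod k (Ms ^t* *m Ms) * topprod k (Mt ^t* *m Mt).
Proof.
move=> psdH MM kn; have [V VV HV] := top_eigenvectors psdH kn.
set L := diag_mx _ in HV.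
(* As [D *m N *m W = W *m L], the columns of [W] carry the top spectrum of [N *m D] over to
   [D *m N]. *)
have [W WE] : {W | W = D *m V} by exists (D *m V).
pose g := \det (W ^t* *m W).
have detL : \det L = (topprod k (N *m D))%:C by rewrite top_eigenvectors_det.
have NW : N *m W = V *m L by rewrite WE mulmxA.
have CW : Ms ^t* *m Mt *m W = W *m L by rewrite MM -mulmxA NW mulmxA -WE.
have a0 := topprod_ge0 (psdmx_gram Ms) kn.
have b0 := topprod_ge0 (psdmx_gram Mt) kn.
(* If the columns of [W] are dependent, Cauchy-Schwarz for [N ^t* *m V] and [W], whose pairing is
   [L], forces [\det L = 0]. *)
have [g0|g0] := eqVneq g 0.
  have := det_cauchy_schwarz (N ^t* *m V) W.
  rewrite -/g g0 mulr0 trmxC_mul trmxCK -mulmxA NW mulmxA VV mul1mx detL.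
  rewrite real_complex_normr => h; apply: le_trans (mulr_ge0 a0 b0).
  by rewrite -lecR.
have gp : 0 < g by rewrite lt_def g0 det_gram_ge0.
have gb (M : 'M[R[i]]_(m, n)) :
    \det ((M *m W) ^t* *m (M *m W)) <= (topprod k (M ^t* *m M))%:C * g.
  have := det_le_topprod W (psdmx_gram M).
  by rewrite (trmxC_mul M W) !mulmxA.
have := le_trans (det_cauchy_schwarz (Ms *m W) (Mt *m W))
  (ler_pM (det_gram_ge0 _) (det_gram_ge0 _) (gb Ms) (gb Mt)).
(* The determinant on the left is [g * \det L], so [g ^+ 2] cancels. *)
have -> : (Ms *m W) ^t* *m (Mt *m W) = W ^t* *m W *m L.
  by rewrite -[RHS]mulmxA -CW (trmxC_mul Ms W) !mulmxA.
rewrite det_mulmx -/g detL normrM exprMn real_complex_normr (ger0_norm (ltW gp)).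
rewrite [X in _ <= X]mulrACA -(expr2 g) [X in X <= _]mulrC.
rewrite (ler_pM2r (exprn_gt0 2 gp)).
by rewrite -rmorphM lecR.
Qed.

(** For top eigenvectors [V] of [Z ^t* *m Z] and [W = Z *m V], the pairing of [M *m W] with
    [M' *m V] is [W ^t* *m W], of determinant [l]; Cauchy-Schwarz gives [l ^+ 2 <= (c * l) * c]. *)
Lemma topprod_gram_mul (R : realType) (m n k : nat)
    (M M' : 'M[R[i]]_(m, n)) : M' ^t* *m M' = M ^t* *m M -> (k <= n)%N ->
  topprod k ((M ^t* *m M') ^t* *m (M ^t* *m M')) <=
    topprod k (M ^t* *m M) ^+ 2.
Proof.
move=> MM kn; set Z := M ^t* *m M'.
have [V VV HV] := top_eigenvectors (psdmx_gram Z) kn.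
set L := diag_mx _ in HV.
have [W WE] : {W | W = Z *m V} by exists (Z *m V).
set l := topprod k (Z ^t* *m Z); set c := topprod k (M ^t* *m M).
have detL : \det L = l%:C by rewrite top_eigenvectors_det.
have l0 : 0 <= l := topprod_ge0 (psdmx_gram Z) kn.
have [->|ln0] := eqVneq l 0; first exact: sqr_ge0.
have lp : 0 < l by rewrite lt_def ln0.
have WW : \det (W ^t* *m W) = l%:C.
  by rewrite WE trmxC_mul -mulmxA (mulmxA _ Z) HV mulmxA VV mul1mx.
have gb : \det ((M *m W) ^t* *m (M *m W)) <= c%:C * l%:C.
  have := det_le_topprod W (psdmx_gram M); rewrite WW.
  by rewrite (trmxC_mul M W) !mulmxA.
have gb' : \det ((M' *m V) ^t* *m (M' *m V)) <= c%:C.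
  have := det_le_topprod V (psdmx_gram M'); rewrite VV det1 mulr1 MM.
  by rewrite trmxC_mul !mulmxA -(mulmxA _ _ M') MM mulmxA.
have := le_trans (det_cauchy_schwarz (M *m W) (M' *m V))
  (ler_pM (det_gram_ge0 _) (det_gram_ge0 _) gb gb').
have -> : (M *m W) ^t* *m (M' *m V) = W ^t* *m W.
  by rewrite (trmxC_mul M W) -mulmxA (mulmxA _ M') -WE.
rewrite WW real_complex_normr; clearbody c l.
by rewrite mulrAC -!rmorphM lecR -(expr2 c) (expr2 l) (ler_pM2r lp).
Qed.

(** * Midpoint log-convexity of bounded functions *)

(* The supremum S satisfies S ^+ 2 <= S, since every point of [0, p] is the
   midpoint of an endpoint and of another point. *)
Lemma midpoint_convex_le1 (R : realType) (f : R -> R) (p K : R) : 0 <= p ->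
  (forall t, 0 <= t <= p -> 0 <= f t <= K) ->
  (forall s t, 0 <= t -> t <= s -> s <= p -> f ((s + t) / 2) ^+ 2 <= f s * f t) ->
  f 0 <= 1 -> f p <= 1 -> forall t, 0 <= t <= p -> f t <= 1.
Proof.
move=> p0 fK fmid f0 fp t tp.
pose E := [set f t | t in [set t | 0 <= t <= p]]%classic.
have E0 : (E !=set0)%classic by exists (f 0), 0 => //=; rewrite lexx.
have Eub : has_ubound E by exists K => _ [s /= /fK /andP[_ ?] <-].
have fS (s : R) : 0 <= s <= p -> f s <= sup E.
  by move=> sp; apply: ub_le_sup => //; exists s.
rewrite leNgt; apply/negP => ft1.
have S1 : 1 < sup E := lt_le_trans ft1 (fS _ tp).
have fsq (s : R) : 0 <= s <= p -> f s ^+ 2 <= sup E.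
  move=> sp; have [sl|sl] := leP s (p / 2).
    have := fmid (s + s) 0; rewrite addr0 -mulr2n -(mulr_natr s) mulfK ?pnatr_eq0 //.
    have s2 : 0 <= s * 2%:R <= p by lra.
    have := fS _ s2; have /andP[? _] := fK _ s2 => h1 h2.
    apply: le_trans (h2 _ _ _) _; try lra.
    by apply: le_trans h1; apply: ler_piMr.
  have := fmid p (s * 2 - p); have -> : (p + (s * 2 - p)) / 2 = s by lra.
  have s2 : 0 <= s * 2 - p <= p by lra.
  have := fS _ s2; have /andP[? _] := fK _ s2 => h1 h2.
  apply: le_trans (h2 _ _ _) _; try lra.
  by apply: le_trans h1; apply: ler_piMl.
have : sup E <= Num.sqrt (sup E).
  apply: ge_sup => // _ [s /= sp <-].
  by have /andP[fs0 _] := fK _ sp; rewrite -(ger0_norm fs0) -sqrtr_sqr ler_wsqrtr // fsq.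
rewrite -[X in X <= _]ger0_norm; last by lra.
rewrite -sqrtr_sqr ler_sqrt; last by lra.
by rewrite expr2 ger_pMr ?leNgt ?S1 // (lt_trans ltr01 S1).
Qed.

(** Dividing [f] by an exponential that dominates it at 0 and at [p] reduces this to
    [midpoint_convex_le1]. *)
Lemma midpoint_log_convex (R : realType) (f : R -> R) (p K a : R) : 1 <= p ->
  (forall t, 0 <= t <= p -> 0 <= f t <= K) ->
  (forall s t, 0 <= t -> t <= s -> s <= p -> f ((s + t) / 2) ^+ 2 <= f s * f t) ->
  0 < a -> f 0 <= a -> f 1 `^ p <= a `^ (p - 1) * f p.
Proof.
move=> p1 fK fmid a0 f0.
have p0 : 0 < p by lra.
have K0 : 0 <= K.
  have /fK/andP[h] : 0 <= (0 : R) <= p by lra.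
  exact: le_trans.
have fp0 : 0 <= f p by have /fK/andP[] : 0 <= p <= p by rewrite lexx andbT ltW.
have f10 : 0 <= f 1 by have /fK/andP[] : 0 <= (1 : R) <= p by rewrite p1 ler01.
(* The exponent [y + z * t] is affine, with values [ln a] at 0 and [ln b] at [p]; a positive [b] is
   needed because [f p] may be 0. *)
have main b : 0 < b -> f p <= b -> f 1 `^ p <= a `^ (p - 1) * b.
  move=> b0 fpb; pose y := ln a; pose z := (ln b - ln a) / p.
  pose g t := expR (- (y + z * t)).
  have h1 : f 1 * g 1 <= 1.
    apply: (@midpoint_convex_le1 _ (fun t => f t * g t) p (K * expR (`|y| + `|z| * p))).
    - lra.
    - move=> t tp; have /andP[ft0 ftK] := fK _ tp.
      rewrite mulr_ge0 ?expR_ge0 //= ler_pM ?expR_ge0 // ler_expR.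
      apply: le_trans (ler_norm _) _; rewrite normrN.
      apply: le_trans (ler_normD _ _) _; rewrite lerD2l normrM ler_wpM2l //.
      by rewrite ger0_norm; lra.
    - move=> s t t0 ts sp.
      have -> : g ((s + t) / 2) = expR (- (y + z * ((s + t) / 2))) by [].
      rewrite exprMn -expRM_natl [X in _ <= X]mulrACA -expRD ler_pM ?sqr_ge0 ?expR_ge0 //.
        exact: fmid.
      by rewrite ler_expR; lra.
    - rewrite /g mulr0 addr0 expRN lnK // ler_pdivrMr // mul1r //.
    - rewrite /g /z -(mulrA (_ - _)) mulVf ?gt_eqF // mulr1 /y addrC subrK.
      by rewrite expRN lnK // ler_pdivrMr // mul1r.
    - lra.
  have h2 : f 1 <= expR (y + z).
    by move: h1; rewrite /g mulr1 expRN ler_pdivrMr ?expR_gt0 // mul1r.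
  have -> : a `^ (p - 1) * b = expR (y + z) `^ p.
    rewrite -expRM /powR gt_eqF // -{1}(lnK b0) -expRD; congr expR.
    by rewrite /z /y; field; rewrite gt_eqF.
  by apply: ge0_ler_powR => //; rewrite ?nnegrE ?expR_ge0 //; lra.
apply/ler_addgt0Pr => e e0; have c0 := powR_gt0 (p - 1) a0.
(* This [b] is positive even if [f p] is 0, and the resulting bound exceeds the wanted one by
   exactly [e]. *)
have := main (f p + e / a `^ (p - 1)).
rewrite mulrDr mulrCA divff ?gt_eqF // mulr1; apply; last first.
  by rewrite lerDl divr_ge0 ?ltW.
by rewrite ltr_wpDl // divr_gt0.
Qed.

(** * Real powers in a fixed eigenbasis; polar form of normal matrices *)

(** For a fixed unitary [P] the powers form a semigroup in [t >= 0]. As 0 to the power 0 is 1, they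
    start from the identity even when [r] has zeros. *)
HB.lock Definition upow (R : realType) (n : nat) (P : 'M[R[i]]_n) (r : 'rV[R]_n)
  (t : R) : 'M[R[i]]_n := unidiag P (map_mx (fun x => (x `^ t)%:C) r).

Lemma conj_real_complex (R : realType) (x : R) : (x%:C)^*%R = x%:C.
Proof. by rewrite conj_Creal // complex_real. Qed.

Lemma upow_trmxC (R : realType) (n : nat) (P : 'M[R[i]]_n) (r : 'rV[R]_n)
    (t : R) : (upow P r t) ^t* = upow P r t.
Proof.
rewrite !upow.unlock unidiag_trmxC; congr unidiag; apply/rowP => i.
by rewrite !mxE conj_real_complex.
Qed.

(** Nonnegative exponents exclude the failure at [x = 0] with [s = - t] nonzero. *)
Lemma powRD_ge0 (R : realType) (x s t : R) : 0 <= s -> 0 <= t ->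
  x `^ (s + t) = x `^ s * x `^ t.
Proof.
move=> s0 t0; have [st|st] := eqVneq (s + t) 0; last first.
  by rewrite powRD // (negPf st).
have -> : s = 0 by lra.
have -> : t = 0 by lra.
by rewrite addr0 powRr0 mulr1.
Qed.

Lemma upow_add (R : realType) (n : nat) (P : 'M[R[i]]_n) (r : 'rV[R]_n)
    (s t : R) : P \is unitarymx -> 0 <= s -> 0 <= t ->
  upow P r s *m upow P r t = upow P r (s + t).
Proof.
move=> uP s0 t0; rewrite !upow.unlock (unidiag_mul _ _ uP); congr unidiag; apply/rowP => i.
by rewrite !mxE powRD_ge0 // rmorphM.
Qed.

Lemma upow0 (R : realType) (n : nat) (P : 'M[R[i]]_n) (r : 'rV[R]_n) :
  P \is unitarymx -> upow P r 0 = 1%:M.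
Proof.
move=> uP; rewrite !upow.unlock -(unidiag1 uP); congr unidiag; apply/rowP => i.
by rewrite !mxE powRr0.
Qed.

Lemma powmx_real_unidiag (R : realType) (n : nat) (P : 'M[R[i]]_n)
    (r : 'rV[R]_n) (t : R) : P \is unitarymx ->
  powmx (unidiag P (map_mx (real_complex R) r)) t = upow P r t.
Proof.
move=> uP; rewrite (powmx_unidiag _ _ uP) !upow.unlock; congr unidiag.
by apply/rowP => i; rewrite !mxE.
Qed.

Lemma psdmx_upow (R : realType) (n : nat) (A : 'M[R[i]]_n) : psdmx A ->
  exists2 P, P \is unitarymx & exists2 r : 'rV[R]_n,
    (forall i, 0 <= r 0 i) & A = upow P r 1 /\ forall t, powmx A t = upow P r t.
Proof.
move=> /psdmx_unidiag [P uP [r r0 ->]]; exists P; [exact: uP|exists r; [exact: r0|split]].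
  by rewrite !upow.unlock; congr unidiag; apply/rowP => i; rewrite !mxE powRr1.
by move=> t; rewrite (powmx_real_unidiag _ _ uP).
Qed.

(** Each eigenvalue is its modulus times a phase; all factors are diagonal in one eigenbasis, so the
    modulus can be split evenly around the phase. *)
Lemma normal_polar (R : realType) (n : nat) (X : 'M[R[i]]_n) :
  X \is normalmx ->
  exists2 P, P \is unitarymx & exists2 r : 'rV[R]_n, (forall i, 0 <= r 0 i) &
  exists2 U, U ^t* *m U = 1%:M &
  X = upow P r 2^-1 *m U *m upow P r 2^-1 /\
  forall t, powmx (absmx X) t = upow P r t.
Proof.
move=> nX; have XE := normal_unidiag nX; have uP := spectral_unitarymx X.
move: (spectralmx X) (spectral_diag X) XE uP => P d XE uP.
have [r rE] : {r : 'rV[R]_n | forall i, (r 0 i)%:C = `|d 0 i|}.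
  exists (map_mx (fun z : R[i] => complex.Re `|z|) d) => i.
  by rewrite mxE RRe_real // normr_real.
have [u uE] : {u : 'rV[R[i]]_n | forall i,
    `|u 0 i| = 1 /\ d 0 i = `|d 0 i| * u 0 i}.
  (* The phase at a zero eigenvalue is set to 1, which keeps [U] unitary. *)
  exists (map_mx (fun z : R[i] => if z == 0 then 1 else z / `|z|) d) => i.
  rewrite mxE; have [->|d0] := eqVneq (d 0 i) 0.
    by rewrite normr1 normr0 mul0r.
  by rewrite normrM normfV normr_id divff ?normr_eq0 // mulrC divfK ?normr_eq0.
have r0 i : 0 <= r 0 i by rewrite -ler0c rE normr_ge0.
exists P; [exact: uP|exists r; [exact: r0|exists (unidiag P u)]].
  rewrite unidiag_trmxC (unidiag_mul _ _ uP) -(unidiag1 uP); congr unidiag.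
  by apply/rowP => i; rewrite !mxE mulrC -normCK (uE i).1 expr1n.
split.
  rewrite [LHS]XE !upow.unlock !(unidiag_mul _ _ uP); congr unidiag; apply/rowP => i.
  rewrite !mxE mulrAC -rmorphM -powRD_ge0 ?invr_ge0 //.
  have -> : 2^-1 + 2^-1 = 1 :> R by lra.
  by rewrite powRr1 //; have [_ ->] := uE i; rewrite -rE.
have -> : absmx X = unidiag P (map_mx (real_complex R) r).
  rewrite /absmx XE unidiag_trmxC (unidiag_mul _ _ uP) (powmx_unidiag _ _ uP).
  congr unidiag; apply/rowP => i; rewrite !mxE mulrC -normCK -rE -rmorphXn /=.
  by rewrite -powR_mulrn // -powRrM divff ?pnatr_eq0 // powRr1.
by move=> t; exact: powmx_real_unidiag.
Qed.

(** * Boundedness on the interval [0, p] *)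

Lemma mxtrace_unidiag (C : numClosedFieldType) (n : nat) (P : 'M[C]_n)
    (d : 'rV[C]_n) : P \is unitarymx -> \tr (unidiag P d) = \sum_i d 0 i.
Proof.
move=> uP; rewrite unidiag_unlock mxtrace_mulC mulmxA (unitarymxP uP) mul1mx.
by rewrite mxtrace_diag.
Qed.

(** The trace is a sum of nonnegative eigenvalues and so bounds each of them. *)
Lemma topprod_le_trace (R : realType) (n k : nat) (H : 'M[R[i]]_n) (K : R) :
  psdmx H -> (k <= n)%N -> `|\tr H| <= K%:C -> topprod k H <= K ^+ k.
Proof.
move=> /psdmx_sorted [l0 _ _ [P uP HE]] kn.
rewrite {1}HE mxtrace_unidiag // => trK.
rewrite -[in X in _ <= _ ^+ X](card_ord k) -prodr_const.
apply: ler_prod => j _; have jn := leq_trans (ltn_ord j) kn.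
rewrite l0 //= -lecR; apply: le_trans trK; rewrite ger0_norm; last first.
  by apply: sumr_ge0 => i _; rewrite mxE ler0c l0.
rewrite (bigD1 (Ordinal jn)) //= mxE lerDl.
by apply: sumr_ge0 => i _; rewrite mxE ler0c l0.
Qed.

(** In [midpoint_log_convex] this crude entrywise bound takes the place of continuity. *)
Definition mxbounded (R : realType) (m n : nat) (p : R)
    (F : R -> 'M[R[i]]_(m, n)) : Prop :=
  exists2 K : R, 0 <= K &
  forall t, 0 <= t <= p -> forall i j, `|F t i j| <= K%:C.

Lemma mxbounded_const (R : realType) (m n : nat) (p : R) (A : 'M[R[i]]_(m, n)) :
  mxbounded p (fun _ => A).
Proof.
have E z : `|z| = (complex.Re `|z|)%:C :> R[i] by rewrite RRe_real // normr_real.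
have N z : 0 <= complex.Re `|z : R[i]| by rewrite -ler0c -E normr_ge0.
exists (\sum_i \sum_j complex.Re `|A i j|).
  by do 2!apply: sumr_ge0 => ? _; exact: N.
move=> t _ i j; rewrite E lecR (bigD1 i) //= (bigD1 j) //= -addrA lerDl.
apply: addr_ge0; first by apply: sumr_ge0 => ? _; exact: N.
by do 2!apply: sumr_ge0 => ? _; exact: N.
Qed.

Lemma mxboundedD (R : realType) (m n : nat) (p : R)
    (F G : R -> 'M[R[i]]_(m, n)) :
  mxbounded p F -> mxbounded p G -> mxbounded p (fun t => F t + G t).
Proof.
move=> [K K0 FK] [L L0 GL]; exists (K + L); first exact: addr_ge0.
move=> t tp i j; rewrite mxE rmorphD; apply: le_trans (ler_normD _ _) _.
by apply: lerD; [exact: FK|exact: GL].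
Qed.

Lemma mxboundedM (R : realType) (m n q : nat) (p : R)
    (F : R -> 'M[R[i]]_(m, n)) (G : R -> 'M[R[i]]_(n, q)) :
  mxbounded p F -> mxbounded p G -> mxbounded p (fun t => F t *m G t).
Proof.
move=> [K K0 FK] [L L0 GL]; exists (\sum_(j < n) K * L).
  by apply: sumr_ge0 => j _; apply: mulr_ge0.
move=> t tp i j; rewrite mxE rmorph_sum; apply: le_trans (ler_norm_sum _ _ _) _.
apply: ler_sum => l _; rewrite normrM rmorphM.
by apply: ler_pM => //; [exact: FK|exact: GL].
Qed.

Lemma powR_le_endpoints (R : realType) (x t p : R) : 0 <= x -> 0 <= t <= p ->
  x `^ t <= 1 + x `^ p.
Proof.
move=> x0 /andP[t0 tp]; have [x1|x1] := leP x 1.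
  apply: (@le_trans _ _ 1); last by rewrite lerDl powR_ge0.
  by have := ge0_ler_powR t0 _ _ x1; rewrite !nnegrE x0 ler01 powR1; apply.
apply: (@le_trans _ _ (x `^ p)); last by rewrite lerDr.
by apply: ler_powR => //; exact: ltW.
Qed.

Lemma mxbounded_upow (R : realType) (n : nat) (p : R) (P : 'M[R[i]]_n)
    (r : 'rV[R]_n) : (forall i, 0 <= r 0 i) -> mxbounded p (upow P r).
Proof.
move=> r0; suff [K K0 HK] : mxbounded p (fun t : R =>
    P ^t* *m diag_mx (map_mx (fun x => (x `^ t)%:C) r) *m P).
  by exists K => // t tp i j; rewrite upow.unlock unidiag_unlock; exact: HK.
apply: mxboundedM; last exact: mxbounded_const.
apply: mxboundedM; first exact: mxbounded_const.
exists (\sum_i (1 + r 0 i `^ p)).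
  by apply: sumr_ge0 => i _; rewrite addr_ge0 ?powR_ge0.
move=> t tp i j; rewrite !mxE; have [->|_] := eqVneq i j; last first.
  rewrite mulr0n normr0 ler0c.
  by apply: sumr_ge0 => l _; rewrite addr_ge0 ?powR_ge0.
rewrite mulr1n ger0_norm ?ler0c ?powR_ge0 // lecR (bigD1 j) //=.
apply: le_trans (powR_le_endpoints (r0 j) tp) _; rewrite lerDl.
by apply: sumr_ge0 => l _; rewrite addr_ge0 ?powR_ge0.
Qed.

(** * Eigenvalue products of multiples and powers *)

Lemma topprod_unidiag (R : realType) (n k : nat) (P : 'M[R[i]]_n)
    (l : nat -> R) : P \is unitarymx ->
  (forall i j, (i <= j)%N -> (j < n)%N -> l j <= l i) -> (k <= n)%N ->
  topprod k (unidiag P (\row_i (l i)%:C)) = \prod_(j < k) l j.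
Proof.
move=> uP ldec kn; apply: eq_bigr => j _; rewrite eigenvalues_unidiag //.
have -> : [seq complex.Re ((\row_(i < n) (l i)%:C) 0 i) | i <- enum 'I_n] =
    mkseq l n.
  rewrite /mkseq -val_enum_ord -map_comp.
  by apply: eq_map => i; rewrite /= mxE.
rewrite sorted_sort ?nth_mkseq ?(leq_trans _ kn) //; first exact: ge_trans.
apply/(sortedP 0) => i; rewrite size_mkseq => i1.
by rewrite !nth_mkseq ?(ltnW i1) //; exact: ldec.
Qed.

Lemma topprodZ (R : realType) (n k : nat) (c : R) (H : 'M[R[i]]_n) :
  psdmx H -> (k <= n)%N -> 0 <= c ->
  topprod k (c%:C *: H) = c ^+ k * topprod k H.
Proof.
move=> /psdmx_sorted [l0 ldec _ [P uP HE]] kn c0.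
rewrite {1}HE unidiagZ.
have -> : c%:C *: (\row_i ((eigenvalues H)`_i)%:C) =
    \row_(i < n) (c * (eigenvalues H)`_i)%:C.
  by apply/rowP => i; rewrite !mxE rmorphM.
rewrite (topprod_unidiag (l := fun i => c * (eigenvalues H)`_i)) //.
  by rewrite big_split /= prodr_const card_ord.
by move=> i j ij jn; rewrite ler_wpM2l // ldec.
Qed.

(** The exponents [2^-1] and [p] compose to [p / 2], a monotone power, which keeps the eigenvalues
    in order. *)
Lemma topprod_powmx_absmx (R : realType) (n k : nat) (Z : 'M[R[i]]_n) (p : R) :
  (k <= n)%N -> 0 <= p ->
  topprod k (powmx (absmx Z) p) = topprod k (Z ^t* *m Z) `^ (p / 2).
Proof.
move=> kn p0; have [l0 ldec _ [P uP HE]] := psdmx_sorted (psdmx_gram Z).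
rewrite /absmx {1}HE !powmx_unidiag //.
set l := fun i => (eigenvalues (Z ^t* *m Z))`_i `^ (p / 2).
have -> : map_mx (fun z : R[i] => (complex.Re z `^ p)%:C)
    (map_mx (fun z : R[i] => (complex.Re z `^ 2^-1)%:C)
      (\row_i ((eigenvalues (Z ^t* *m Z))`_i)%:C)) = \row_(i < n) (l i)%:C.
  by apply/rowP => i; rewrite !mxE /= -powRrM mulrC.
rewrite (topprod_unidiag (l := l)) // => [|i j ij jn]; last first.
  have jn' := leq_ltn_trans ij jn.
  by apply: ge0_ler_powR; rewrite ?nnegrE ?l0 ?ldec ?divr_ge0.
rewrite /topprod; elim: k kn => [|k IH] kn; first by rewrite !big_ord0 powR1.
rewrite !big_ord_recr /= (IH (ltnW kn)) powRM ?l0 //.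
by apply: prodr_ge0 => j _; apply: l0; exact: ltn_trans (ltn_ord j) kn.
Qed.

(** * Block columns and interpolation in the exponent *)

Lemma col_mx_gram (C : numClosedFieldType) (m n q : nat)
    (S T S' T' : 'M[C]_(m, n)) (A A' : 'M[C]_(n, q)) :
  (col_mx (S *m A) (T *m A)) ^t* *m col_mx (S' *m A') (T' *m A') =
  A ^t* *m (S ^t* *m S' + T ^t* *m T') *m A'.
Proof.
by rewrite tr_col_mx map_row_mx mul_row_col !trmxC_mul mulmxDr mulmxDl !mulmxA.
Qed.

Lemma gram_isometry (C : numClosedFieldType) (m n q : nat)
    (U : 'M[C]_(m, n)) (S : 'M[C]_(n, q)) : U ^t* *m U = 1%:M ->
  (U *m S) ^t* *m (U *m S) = S ^t* *m S.
Proof. by move=> UU; rewrite trmxC_mul mulmxA -(mulmxA _ _ U) UU mulmx1. Qed.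

(** The block column M_t, where [A], [B], [C] are eigenbases and [a], [b], [c] the eigenvalues. *)
Definition upow_stack (R : realType) (n : nat) (A B C : 'M[R[i]]_n)
    (a b c : 'rV[R]_n) (t : R) : 'M[R[i]]_(n + n, n) :=
  col_mx (upow B b (t / 2) *m upow A a t) (upow C c (t / 2) *m upow A a t).

Lemma upow_stack_gram (R : realType) (n : nat) (A B C : 'M[R[i]]_n)
    (a b c : 'rV[R]_n) (s t : R) :
  B \is unitarymx -> C \is unitarymx -> 0 <= s -> 0 <= t ->
  (upow_stack A B C a b c s) ^t* *m upow_stack A B C a b c t =
  upow A a s *m (upow B b ((s + t) / 2) + upow C c ((s + t) / 2)) *m upow A a t.
Proof.
move=> uB uC s0 t0; rewrite /upow_stack col_mx_gram !upow_trmxC.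
have s2 : 0 <= s / 2 by rewrite divr_ge0.
have t2 : 0 <= t / 2 by rewrite divr_ge0.
by rewrite (upow_add b uB s2 t2) (upow_add c uC s2 t2) -mulrDl.
Qed.

Lemma upow_stack_norm (R : realType) (n : nat) (A B C : 'M[R[i]]_n)
    (a b c : 'rV[R]_n) (t : R) : B \is unitarymx -> C \is unitarymx -> 0 <= t ->
  (upow_stack A B C a b c t) ^t* *m upow_stack A B C a b c t =
  upow A a t *m (upow B b t + upow C c t) *m upow A a t.
Proof. by move=> uB uC t0; rewrite upow_stack_gram // mulrDl -splitr. Qed.

Lemma topprod_interpolation (R : realType) (n k : nat) (A B C : 'M[R[i]]_n)
    (a b c : 'rV[R]_n) (p : R)
    (f := fun t => topprod k
      (upow A a t *m (upow B b t + upow C c t) *m upow A a t)) :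
  A \is unitarymx -> B \is unitarymx -> C \is unitarymx ->
  (forall i, 0 <= a 0 i) -> (forall i, 0 <= b 0 i) -> (forall i, 0 <= c 0 i) ->
  1 <= p -> (k <= n)%N -> f 1 `^ p <= (2 ^+ k) `^ (p - 1) * f p.
Proof.
move=> uA uB uC a0 b0 c0 p1 kn; rewrite {}/f.
set H := fun t => upow A a t *m (upow B b t + upow C c t) *m upow A a t.
pose M := upow_stack A B C a b c.
have MM t : 0 <= t -> H t = (M t) ^t* *m M t.
  by move=> t0; rewrite /M upow_stack_norm.
have Hpsd t : 0 <= t -> psdmx (H t).
  by move=> t0; rewrite MM //; exact: psdmx_gram.
have [K K0 HK] : mxbounded p H.
  do 2?[apply: mxboundedM]; try exact: mxbounded_upow.
  by apply: mxboundedD; exact: mxbounded_upow.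
(* Each eigenvalue of [H t] is at most the trace, hence at most [n] times the entry bound [K]. *)
apply: (@midpoint_log_convex _ (fun t => topprod k (H t)) p
  ((\sum_(i < n) K) ^+ k)).
- exact: p1.
- move=> t /[dup] tp /andP[t0 _]; rewrite topprod_ge0 //=; last exact: Hpsd.
  apply: topprod_le_trace => //; first exact: Hpsd.
  rewrite rmorph_sum; apply: le_trans (ler_norm_sum _ _ _) _.
  by apply: ler_sum => i _; apply: HK.
- move=> s t t0 ts sp; have s0 := le_trans t0 ts.
  set m := (s + t) / 2; set d := (s - t) / 2.
  have m0 : 0 <= m by rewrite /m; lra.
  have d0 : 0 <= d by rewrite /d; lra.
  (* Moving the factor [upow A a d] from the right end of [H m] to the left gives
     [(M s) ^t* *m M t], since [m = t + d] and [s = d + m]; [t <= s] makes [d] nonnegative. *)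
  pose N := upow A a m *m (upow B b m + upow C c m) *m upow A a t.
  have md : t + d = m by rewrite /m /d; lra.
  have dm : d + m = s by rewrite /m /d; lra.
  have E : H m = N *m upow A a d.
    by rewrite /N -mulmxA (upow_add a uA t0 d0) md.
  rewrite (MM s s0) (MM t t0) E; apply: topprod_swap => //.
    by rewrite -E; exact: Hpsd.
  rewrite /M (upow_stack_gram _ _ _ _ uB uC s0 t0) -/m -dm.
  by rewrite -(upow_add a uA d0 m0) /N -!(mulmxA (upow A a d)).
- by rewrite exprn_gt0.
(* All powers at 0 are the identity, so [H 0] is twice the identity. *)
- have -> : H 0 = unidiag A (\row_(i < n) (2 : R)%:C).
    rewrite /H !upow0 // mul1mx mulmx1 -(unidiag1 uA).
    have -> : \row_(i < n) (2 : R)%:C = 2 *: const_mx 1.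
      by apply/rowP => i; rewrite !mxE mulr1 rmorph_nat.
    by rewrite -unidiagZ scaler_nat mulr2n.
  by rewrite (topprod_unidiag (l := fun _ => 2)) // prodr_const card_ord.
Qed.

(** * From eigenvalue products to log-majorization *)

Lemma powR_half_le (R : realType) (x y p : R) : 0 <= p -> 0 <= x -> 0 <= y ->
  x <= y ^+ 2 -> x `^ (p / 2) <= y `^ p.
Proof.
move=> p0 x0 y0 xy.
have -> : y `^ p = (y ^+ 2) `^ (p / 2).
  by rewrite -powR_mulrn // -powRrM mulrCA divff ?mulr1 ?pnatr_eq0.
by apply: ge0_ler_powR; rewrite ?nnegrE ?divr_ge0 ?sqr_ge0.
Qed.

Lemma wlog_maj_topprod (R : realType) (n : nat) (S T : 'M[R[i]]_n) :
  (forall k, (k <= n)%N -> topprod k S <= topprod k T) -> wlog_maj S T.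
Proof. by move=> ST k /andP[_]; exact: ST. Qed.

Unset Implicit Arguments.
Set Strict Implicit.

Theorem proposition1p1 (R : realType) (n : nat) (A X Y : 'M[R[i]]_n)
    (hA : psdmx A) (hX : X \is normalmx) (hY : Y \is normalmx)
    (p : R) (hp : 1 <= p) :
  wlog_maj
    (powmx (absmx (A *m (X + Y) *m A)) p)
    ((2 `^ (p - 1))%:C *:
       (powmx A p *m (powmx (absmx X) p + powmx (absmx Y) p) *m powmx A p)).
Proof.
have p0 : 0 <= p by lra.
have [PA uA [a a0 [AE powA]]] := psdmx_upow hA.
have [PX uX [x x0 [U UU [XE powX]]]] := normal_polar hX.
have [PY uY [y y0 [V VV [YE powY]]]] := normal_polar hY.
pose M := upow_stack PA PX PY a x y 1.
(* The unitary polar factors are put on the blocks of [M]; this leaves the Gram matrix unchanged and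
   makes [M ^t* *m M'] equal to [A *m (X + Y) *m A]. *)
pose M' := col_mx (U *m upow PX x 2^-1 *m upow PA a 1)
                  (V *m upow PY y 2^-1 *m upow PA a 1).
have M'M' : M' ^t* *m M' = M ^t* *m M.
  rewrite /M' /M /upow_stack mul1r [LHS]col_mx_gram [RHS]col_mx_gram.
  by rewrite (gram_isometry _ UU) (gram_isometry _ VV).
have ZE : A *m (X + Y) *m A = M ^t* *m M'.
  have := col_mx_gram (upow PX x 2^-1) (upow PY y 2^-1) (U *m upow PX x 2^-1)
    (V *m upow PY y 2^-1) (upow PA a 1) (upow PA a 1).
  rewrite !upow_trmxC -AE (mulmxA (upow PX x _)) -XE (mulmxA (upow PY y _)) -YE.
  by rewrite /M' /M /upow_stack mul1r -AE => ->.
apply: wlog_maj_topprod => k kn; rewrite !powA powX powY.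
rewrite (topprod_powmx_absmx _ kn p0) ZE.
(* [topprod_gram_mul] compares squared singular values with a square, which the exponent [p / 2]
   undoes. *)
apply: (@le_trans _ _ (topprod k (M ^t* *m M) `^ p)).
  by apply: (powR_half_le p0 _ _ (topprod_gram_mul M'M' kn));
    apply: topprod_ge0 (psdmx_gram _) kn.
have psdp :
    psdmx (upow PA a p *m (upow PX x p + upow PY y p) *m upow PA a p).
  by rewrite -(upow_stack_norm PA a x y uX uY p0); exact: psdmx_gram.
rewrite (topprodZ psdp kn (powR_ge0 _ _)).
have -> : (2 `^ (p - 1)) ^+ k = (2 ^+ k) `^ (p - 1) :> R.
  by rewrite -powR_mulrn ?powR_ge0 // powRAC powR_mulrn.
rewrite /M (upow_stack_norm PA a x y uX uY ler01).
exact: topprod_interpolation uA uX uY a0 x0 y0 hp kn.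
Qed.
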